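(* Let $f\colon\mathbb{R}^{m\times n}\to\mathbb{R}$ be continuously differentiable and $g\colon\mathcal{M}\to\mathbb{R}$, $g(X,P)=f(X)$. Then $\|\nabla g(X,P)\|\le\|\nabla f(X)\|_{\mathrm F}$ for all $(X,P)\in\mathcal{M}$, where $\nabla g$ is the Riemannian gradient of $g$ and $\nabla f$ the Euclidean gradient of $f$.
   Context: Let $m,n,r$ be positive integers with $r<\min(m,n)$. $\mathrm{Sym}(n)$: real symmetric $n\times n$ matrices; $\mathrm{Gr}(n,n-r)=\{P\in\mathrm{Sym}(n):P^2=P,\ \mathrm{rank}\,P=n-r\}$. The desingularization $\mathcal{M}=\{(X,P)\in\mathbb{R}^{m\times n}\times\mathrm{Gr}(n,n-r):XP=0\}$ is a smooth embedded submanifold of $\mathcal{E}=\mathbb{R}^{m\times n}\times\mathrm{Sym}(n)$. $\mathcal{M}$ is a Riemannian submanifold of $\mathcal{E}$ with inner product $\langle(Y_1,Z_1),(Y_2,Z_2)\rangle=\langle Y_1,Y_2\rangle+\alpha\langle Z_1,Z_2\rangle$, $\alpha>0$ fixed (Frobenius inner products on the right); $\|\cdot\|$ is the induced norm on tangent spaces and $\|\cdot\|_{\mathrm F}$ the Frobenius norm. *)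

(* Defs.v *)
From HB Require Import structures.
From mathcomp Require Import all_boot all_order all_algebra.
From mathcomp Require Import all_classical all_reals all_analysis.

Set Implicit Arguments.
Unset Strict Implicit.
Unset Printing Implicit Defensive.

Import Order.TTheory GRing.Theory Num.Theory.
Import numFieldNormedType.Exports.
Local Open Scope classical_set_scope.
Local Open Scope ring_scope.

Definition frob {R : realType} {m n : nat} (A B : 'M[R]_(m, n)) : R :=
  \tr (A^T *m B).

Definition frob_norm {R : realType} {m n : nat} (A : 'M[R]_(m, n)) : R :=
  Num.sqrt (frob A A).

Definition egrad {R : realType} {m n : nat} (f : 'M[R]_(m, n) -> R)
    (X : 'M[R]_(m, n)) : 'M[R]_(m, n) :=
  \matrix_(i, j) 'D_(delta_mx i j) f X.

Definition continuously_differentiable {R : realType} {m n : nat}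
    (f : 'M[R]_(m, n) -> R) : Prop :=
  (forall X, differentiable f X) /\ continuous (egrad f).

(* C^oo curves through x at time 0 that stay in M; both smoothness and
   membership are required on an open interval around 0 only. *)
Definition curve_through {R : realType} {V : normedModType R} (M : set V)
    (x : V) : set (R -> V) :=
  [set c | [/\ c 0 = x, \forall t \near (0 : R), M (c t) &
               \forall t \near (0 : R), forall k, derivable (derive1n k c) t 1]].

Definition tangent_space {R : realType} {V : normedModType R} (M : set V)
    (x : V) : set V :=
  [set derive1 c 0 | c in curve_through M x].

(* G is tangent to M at x and represents Dg(x) : c'(0) |-> (g o c)'(0) for the
   inner product ip. Only the values of g on M matter. *)
Definition is_rgrad {R : realType} {V : normedModType R} (ip : V -> V -> R)
    (M : set V) (g : V -> R) (x G : V) : Prop :=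
  tangent_space M x G /\
  forall c, curve_through M x c ->
    is_derive (0 : R) 1 (g \o c) (ip G (derive1 c 0)).

(* The default 0 is irrelevant when M is an embedded submanifold, g is
   differentiable on M and ip is positive definite: the gradient then exists
   and is unique. *)
Definition rgrad {R : realType} {V : normedModType R} (ip : V -> V -> R)
    (M : set V) (g : V -> R) (x : V) : V :=
  xget 0 [set G | is_rgrad ip M g x G].

(* Gr(n, k), as a subset of the space of all square matrices *)
Definition grassmann {R : realType} (n k : nat) : set 'M[R]_n :=
  [set P | [/\ P^T = P, P *m P = P & \rank P = k]].

(* The ambient space Sym(n) is enlarged to all square matrices: points of the
   set, hence velocities of its curves, have a symmetric second component. *)
Definition desing {R : realType} (m n r : nat) :
    set ('M[R]_(m, n) * 'M[R]_n)%type :=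
  [set x | grassmann (n - r) x.2 /\ x.1 *m x.2 = 0].

Definition ipE {R : realType} {m n : nat} (alpha : R)
    (v w : 'M[R]_(m, n) * 'M[R]_n) : R :=
  frob v.1 w.1 + alpha * frob v.2 w.2.

Definition normE {R : realType} {m n : nat} (alpha : R)
    (v : 'M[R]_(m, n) * 'M[R]_n) : R :=
  Num.sqrt (ipE alpha v v).

(* Main.v *)
(** Let [G] be the gradient of [g]. Since [g] agrees with [f \o fst] on the
    desingularization, differentiating along a curve with velocity [G] gives
    [|G|^2 = <grad f X, G.1>]. Expanding [0 <= |grad f X - G.1|^2] and using
    [|G.1| <= |G|] yields [2 |G|^2 <= |grad f X|^2 + |G|^2]. *)

Require Import Defs.
From HB Require Import structures.
From mathcomp Require Import all_boot all_order all_algebra.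
From mathcomp Require Import all_classical all_reals all_analysis.
From mathcomp Require Import lra.

Set Implicit Arguments.
Unset Strict Implicit.
Unset Printing Implicit Defensive.

Import Order.TTheory GRing.Theory Num.Theory.
Import numFieldNormedType.Exports.
Local Open Scope classical_set_scope.
Local Open Scope ring_scope.

Lemma frobE (R : realType) (m n : nat) (A B : 'M[R]_(m, n)) :
  frob A B = \sum_i \sum_j A i j * B i j.
Proof.
rewrite /frob /mxtrace exchange_big; apply: eq_bigr => j _ /=.
by rewrite mxE; apply: eq_bigr => i _; rewrite mxE.
Qed.

Lemma frob_ge0 (R : realType) (m n : nat) (A : 'M[R]_(m, n)) : 0 <= frob A A.
Proof.
by rewrite frobE; do 2!apply: sumr_ge0 => ? _; rewrite -expr2 sqr_ge0.
Qed.

Lemma frobBB (R : realType) (m n : nat) (A B : 'M[R]_(m, n)) :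
  frob (A - B) (A - B) = frob A A - frob A B *+ 2 + frob B B.
Proof.
rewrite !frobE -!sumrMnl -!sumrB -!big_split /=; apply: eq_bigr => i _.
rewrite -!sumrMnl -!sumrB -!big_split /=; apply: eq_bigr => j _.
by rewrite !mxE -!expr2 sqrrB.
Qed.

(** Expand [Y] in the basis [delta_mx i j]: by linearity of the differential, the coefficients are
    paired with the partial derivatives collected in [egrad f X]. *)
Lemma diff_egrad (R : realType) (m n : nat) (f : 'M[R]_(m, n) -> R)
    (X Y : 'M[R]_(m, n)) :
  differentiable f X -> 'd f X Y = frob (egrad f X) Y.
Proof.
move=> df; rewrite frobE {1}(matrix_sum_delta Y) linear_sum /=.
apply: eq_bigr => i _; rewrite linear_sum /=; apply: eq_bigr => j _.
by rewrite linearZ /= mxE deriveE// mulrC.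
Qed.

Lemma is_diff_fst (R : realType) (U V : normedModType R) (x : U * V) :
  is_diff x (@fst U V) (@fst U V).
Proof.
have fstC : continuous (@fst U V) by move=> y; exact: cvg_fst.
by apply: DiffDef; [exact: linear_differentiable|exact: diff_lin].
Qed.

(** Chain rule for [c], then the projection, then [f]. The projection is linear, hence its own
    differential, so only the first component of the velocity survives. *)
Lemma curve_through_is_derive (R : realType) (U V : normedModType R)
    (M : set (U * V)) (u : U) (v : V) (c : R -> U * V) (f : U -> R) :
  curve_through M (u, v) c -> differentiable f u ->
  is_derive (0 : R) 1 (f \o (fst \o c)) ('d f u (derive1 c 0).1).
Proof.
(* Smoothness of the curve is read at time 0 and order 0, where [derive1n 0 c] is [c] itself. *)
move=> [c0 _ /nbhs_singleton/(_ 0%N) dc] df.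
have {}dc : differentiable c 0 by exact/derivable1_diffP.
have dfst : is_diff (c 0) (@fst U V) (@fst U V) by exact: is_diff_fst.
have dfc : differentiable (fst \o c) 0 by exact: differentiable_comp.
have df' : differentiable f ((fst \o c) 0) by rewrite /= c0.
have dfcc : differentiable (f \o (fst \o c)) 0 by exact: differentiable_comp.
apply: DeriveDef; first exact/derivable1_diffP.
rewrite deriveE// diff_comp//= (diff_comp dc)//= diff_val c0.
by rewrite derive1E deriveE.
Qed.

Theorem proposition4p4 (R : realType) (m n r : nat) (alpha : R)
    (m_gt0 : (0 < m)%N) (n_gt0 : (0 < n)%N) (r_gt0 : (0 < r)%N)
    (r_lt : (r < minn m n)%N) (alpha_gt0 : 0 < alpha)
    (f : 'M[R]_(m, n) -> R) (f_C1 : continuously_differentiable f)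
    (g : 'M[R]_(m, n) * 'M[R]_n -> R)
    (gE : forall X P, desing r (X, P) -> g (X, P) = f X)
    (X : 'M[R]_(m, n)) (P : 'M[R]_n) (XP : desing r (X, P)) :
  normE alpha (rgrad (ipE alpha) (desing r) g (X, P)) <= frob_norm (egrad f X).
Proof.
have frob2_ge0 (Z : 'M[R]_n) : 0 <= alpha * frob Z Z.
  exact: mulr_ge0 (ltW alpha_gt0) (frob_ge0 _).
rewrite /normE /frob_norm ler_wsqrtr//.
(* Tangency of [G] supplies a curve [c] with velocity [G]; the gradient identity is tested on this
   very curve. In the other case [xget] returns its default 0, of norm 0. *)
rewrite /rgrad; case: xgetP => [G _ [[c cM cG] /(_ c cM)]|_]; last first.
  by rewrite /ipE /frob !mulmx0 !mxtrace0 mulr0 addr0 -/(frob _ _) frob_ge0.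
rewrite cG => dg.
have df : differentiable f X by case: f_C1.
have := curve_through_is_derive cM df; rewrite cG diff_egrad// => dfc.
(* [g] is tied to [f] on the desingularization only, where [c] stays for small times; agreement near
   0 is enough to compare derivatives. *)
have gfc : \forall t \near (0 : R), (f \o (fst \o c)) t = (g \o c) t.
  case: cM => c0 cM' _; near=> t; have : desing r (c t) by near: t.
  by rewrite /=; case: (c t) => Y Q YQ; rewrite gE.
have GE : ipE alpha G G = frob (egrad f X) G.1.
  (* Both sides are the derivative of [g \o c] at 0. *)
  have := near_eq_is_derive gfc dfc.
  by case: dg => _ <- [_ <-].
have ipGG : ipE alpha G G = frob G.1 G.1 + alpha * frob G.2 G.2 by [].
by have := frob2_ge0 G.2; have := frob_ge0 (egrad f X - G.1); rewrite frobBB; lra.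
Unshelve. all: by end_near. Qed.
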